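(* Let $X$ be a finite non-empty set equipped with the discrete topology, and give $X^\omega$ the product topology. If $S \subseteq X^\omega$ is of first category, then there exists a function $f:\omega\rightarrow\bigcup_{n\in\omega}X^n$ such that for every sequence $\{a_n\}_{n\in\omega}$ belonging to $S$, the set of $i\in\omega$ for which the infinite sequence $\{a_{i+n}\}_{n\in\omega}$ extends the finite sequence $f(i)$ is finite.
   Context: $\omega$ denotes the set of natural numbers $\{0,1,2,\dots\}$, and $X^n$ is the set of finite sequences of length $n$ of elements of $X$. An infinite sequence $\{b_n\}_{n\in\omega}$ extends a finite sequence $(c_0,\dots,c_{m-1})\in X^m$ if $b_j=c_j$ for all $j<m$. A set is of first category if it is a countable union of nowhere dense sets. *)

(* Defs.v *)
From HB Require Import structures.
From mathcomp Require Import all_boot.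
From mathcomp Require Import all_classical topology.

Set Implicit Arguments.
Unset Strict Implicit.
Unset Printing Implicit Defensive.

Local Open Scope classical_set_scope.

Definition nowhere_dense (T : topologicalType) (A : set T) : Prop :=
  interior (closure A) = set0.

(* [nowhere_dense set0] holds, so families indexed by [nat] also cover finite
   and empty unions. *)
Definition first_category (T : topologicalType) (S : set T) : Prop :=
  exists2 F : nat -> set T,
    (forall n, nowhere_dense (F n)) & S = \bigcup_n F n.

Definition extends (X : Type) (b : nat -> X) (c : seq X) : Prop :=
  forall j : 'I_(size c), b j = tnth (in_tuple c) j.

(* Main.v *)
(** Write [S] as the union of nowhere dense sets [F k].  Every finite sequence
    has an extension whose cylinder misses [F k].  There are only finitely many
    pairs of a [k <= i] and a prefix [w] of length [i], so, handling them one
    after the other, one finds a single word [f i] such that the cylinder of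
    [w ++ f i] misses [F k] for all of them.  A sequence of [F k] then carries
    [f i] at position [i] only if [i < k]. *)

Require Import Defs.
From mathcomp Require Import all_boot.
From mathcomp Require Import all_classical topology.

Local Open Scope classical_set_scope.

Lemma extendsE (X : Type) (b : nat -> X) (c : seq X) :
  extends b c <-> mkseq b (size c) = c.
Proof.
split=> [bc|bc j].
  apply: (@eq_from_nth _ (b 0)) => [|i]; rewrite size_mkseq // => ic.
  by rewrite nth_mkseq // (bc (Ordinal ic)) (tnth_nth (b 0)).
by rewrite (tnth_nth (b 0)) /= -[LHS](nth_mkseq (b 0) b (ltn_ord j)) bc.
Qed.

Lemma extends_mkseq (X : Type) (b : nat -> X) (n : nat) :
  extends b (mkseq b n).
Proof. by apply/extendsE; rewrite size_mkseq. Qed.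

Lemma mkseqD (X : Type) (b : nat -> X) (m n : nat) :
  mkseq b (m + n) = mkseq b m ++ mkseq (fun k => b (m + k)) n.
Proof.
rewrite /mkseq iotaD map_cat add0n; congr (_ ++ _).
by rewrite -[X in iota X n]addn0 iotaDl -map_comp.
Qed.

Lemma extends_cat (X : eqType) (b : nat -> X) (s t : seq X) :
  extends b (s ++ t) <-> extends b s /\ extends (fun n => b (size s + n)) t.
Proof.
rewrite !extendsE size_cat mkseqD.
split=> [/eqP|[-> ->] //].
by rewrite eqseq_cat ?size_mkseq // => /andP[/eqP ? /eqP].
Qed.

(** The cylinders around [b] form a neighbourhood base, which reduces the topology to words. A
    cylinder is a finite intersection of conditions on single coordinates, each open because [X] is
    discrete. *)
Lemma nbhs_ptws_discreteP (X : choiceType)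
    (b : {ptws nat -> discrete_topology X})
    (A : set {ptws nat -> discrete_topology X}) :
  nbhs b A <->
  exists m, forall a : nat -> X, mkseq a m = mkseq b m -> A a.
Proof.
pose U m : set {ptws nat -> discrete_topology X} :=
  [set a | mkseq a m = mkseq b m].
have mkseq_eqP (a : nat -> X) m :
    mkseq a m = mkseq b m <-> forall j, j < m -> a j = b j.
  split=> [abm j jm|ab]; last first.
    by apply/eq_in_map => j; rewrite mem_iota add0n => /andP[_ /ab].
  by rewrite -(nth_mkseq (a 0) a jm) abm nth_mkseq.
split=> [bA|[m mA]]; last first.
  suff : nbhs b (U m) by apply: filterS => a; exact: mA.
  elim: m {mA} => [|m IHm]; first by apply: filterS filterT.
  have bm : nbhs b [set a : {ptws nat -> discrete_topology X} | a m = b m].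
    exact: (@proj_continuous nat (fun=> discrete_topology X) m b [set b m]).
  apply: filterS2 IHm bm => a am abm.
  by rewrite /U /= -addn1 !mkseqD am /mkseq /= addn0 abm.
(* The filter [G] generated by the cylinders converges to [b] at each coordinate, hence in the
   product topology, so it contains every neighbourhood of [b]. *)
pose G : set_system {ptws nat -> discrete_topology X} := filter_from setT U.
have GF : Filter G.
  apply: filter_fromT_filter; first by exists 0.
  move=> i j; exists (maxn i j) => a /mkseq_eqP ab.
  by split; apply/mkseq_eqP => k kij; apply: ab; rewrite leq_max kij ?orbT.
have [] : G A; last by move=> m _ mA; exists m.
suff : {ptws, G --> b} by apply.
apply/pointwise_cvgP => t B Bt; exists t.+1 => // a /mkseq_eqP ab /=.
by rewrite /= ab //; exact: nbhs_singleton Bt.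
Qed.

(** Otherwise [A] would meet every cylinder inside that of [s], and its closure would contain the
    whole cylinder of [s]. *)
Lemma nowhere_dense_avoid (X : choiceType) (x0 : X)
    (A : set {ptws nat -> discrete_topology X}) (s : seq X) :
  nowhere_dense A ->
  exists d, forall a : nat -> X, A a -> ~ extends a (s ++ d).
Proof.
move=> ndA; apply: contrapT => /forallNP sA.
(* Padding [s] with [x0] gives a point of its cylinder. *)
have : interior (closure A) (nth x0 s : {ptws nat -> discrete_topology X}).
  apply/nbhs_ptws_discreteP; exists (size s) => b.
  rewrite mkseq_nth => bs B /nbhs_ptws_discreteP[m mB].
  (* Extending [s] by the next [m] letters of [b] yields a point of [A] that agrees with [b] on
     [size s + m] letters, hence on the [m] that [B] requires. *)
  have /existsNP[a /not_implyP[Aa /contrapT]] :=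
    sA (mkseq (fun n => b (size s + n)) m).
  move=> /extends_cat[/extendsE as_ /extendsE]; rewrite size_mkseq => asm.
  exists a; split=> //; apply: mB.
  have: mkseq a (size s + m) = mkseq b (size s + m).
    by rewrite !mkseqD as_ bs asm.
  by move=> /(congr1 (take m)); rewrite /mkseq -!map_take take_iota
    (minn_idPl (leq_addl _ _)).
by rewrite ndA.
Qed.

(** Lengthening [c] to treat one more pair is harmless to the others, since it only shrinks their
    cylinders. *)
Lemma nowhere_dense_avoid_seq (X : choiceType) (I : eqType) (x0 : X)
    (F : I -> set {ptws nat -> discrete_topology X}) (r : seq (I * seq X)) :
  (forall k, nowhere_dense (F k)) ->
  exists c, forall k w, (k, w) \in r ->
    forall a : nat -> X, F k a -> ~ extends a (w ++ c).
Proof.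
move=> ndF; elim: r => [|[k w] r [c cP]]; first by exists [::].
have [d dP] := nowhere_dense_avoid _ x0 _ (w ++ c) (ndF k).
exists (c ++ d) => k' w'; rewrite inE => /predU1P[[-> ->]|rk] a Fa.
  by rewrite catA; exact: dP.
by rewrite catA => /extends_cat[+ _]; exact: cP rk _ Fa.
Qed.

Theorem theorem2 (X : finType) (X_gt0 : 0 < #|X|)
    (S : set {ptws nat -> discrete_topology X}) (hS : first_category S) :
  exists f : nat -> seq X,
    forall a : nat -> X, S a ->
      finite_set [set i : nat | extends (fun n => a (i + n)) (f i)].
Proof.
have /card_gt0P[x0 _] := X_gt0; case: hS => F ndF ->.
have /choice[f fP] : forall i, exists c, forall (k : 'I_i.+1) (w : i.-tuple X)
    (a : nat -> X), F k a -> ~ extends a (w ++ c).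
  (* Finiteness of [X] enters here: it makes the pairs enumerable by a list. *)
  move=> i; pose r := [seq (val p.1, val p.2) | p : 'I_i.+1 * i.-tuple X].
  have [c cP] := nowhere_dense_avoid_seq _ _ x0 _ r ndF.
  by exists c => k w; apply: cP; apply/mapP; exists (k, w); rewrite ?mem_enum.
exists f => a [k _ Fa]; apply: sub_finite_set (finite_II k) => i /= fia.
rewrite ltnNge; apply/negP => ki.
have kS : k < i.+1 by [].
(* The prefix to use is that of [a] itself. *)
apply: (fP i (Ordinal kS) [tuple of mkseq a i] a) => //.
apply/extends_cat; split; first exact: extends_mkseq.
by rewrite size_mkseq.
Qed.
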